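(* The Viviani's curve $\varphi=\lambda$ is the only spherical curve (with $z$ non-constant, up to rotations around the $z$-axis) with spherical angular momentum $\mathcal K(\varphi)=-\cos^2\varphi/\sqrt{1+\cos^2\varphi}$.
   Context: $\mathbb{S}^2\subset\mathbb{R}^3$ is the unit sphere centred at the origin, with geographical coordinates latitude $\varphi$ and longitude $\lambda$, so that a spherical curve, parametrized by arc length $s$, is $\xi=(x,y,z)=(\cos\varphi\cos\lambda,\cos\varphi\sin\lambda,\sin\varphi)$; a dot denotes the derivative with respect to $s$. The spherical angular momentum of $\xi$ with respect to the $z$-axis is $\mathcal K=-\det(\xi,\dot\xi,(0,0,1))=\dot x\,y-x\,\dot y=-\dot\lambda\cos^2\varphi$, considered here as a function of $\varphi$ (equivalently of $z=\sin\varphi$). The Viviani's curve of $\mathbb{S}^2$ is described in geographical coordinates by $\varphi=\lambda$. *)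

(* Defs.v *)
From Stdlib Require Import Reals Lra.
From Coquelicot Require Import Coquelicot.
Open Scope R_scope.

Definition vec3 : Type := (R * R * R)%type.

Definition px (p : vec3) : R := fst (fst p).
Definition py (p : vec3) : R := snd (fst p).
Definition pz (p : vec3) : R := snd p.

Definition euclid_norm (p : vec3) : R :=
  sqrt ((px p) ^ 2 + (py p) ^ 2 + (pz p) ^ 2).

Definition det3 (u v w : vec3) : R :=
    px u * (py v * pz w - pz v * py w)
  - py u * (px v * pz w - pz v * px w)
  + pz u * (px v * py w - py v * px w).

Definition rot_z (theta : R) (p : vec3) : vec3 :=
  (cos theta * px p - sin theta * py p,
   sin theta * px p + cos theta * py p,
   pz p).

Definition geographic (phi lam : R) : vec3 :=
  (cos phi * cos lam, cos phi * sin lam, sin phi).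

(* Normalised to [- PI / 2, PI / 2]. *)
Definition latitude (p : vec3) : R := asin (pz p).

(* The curve phi = lam.  The parameter runs over the whole real line (period
   2 * PI), so that the curve is the complete figure eight; restricting it to
   [- PI / 2, PI / 2] would give only the half running from one pole to the
   other. *)
Definition viviani (t : R) : vec3 := geographic t t.

Definition in_interval (a b : Rbar) (s : R) : Prop :=
  Rbar_lt a s /\ Rbar_lt s b.

Definition ex_velocity (xi : R -> vec3) (s : R) : Prop :=
  ex_derive (fun u => px (xi u)) s /\
  ex_derive (fun u => py (xi u)) s /\
  ex_derive (fun u => pz (xi u)) s.

Definition velocity (xi : R -> vec3) (s : R) : vec3 :=
  (Derive (fun u => px (xi u)) s,
   Derive (fun u => py (xi u)) s,
   Derive (fun u => pz (xi u)) s).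

Definition smooth (xi : R -> vec3) : Prop :=
  forall (n : nat) (s : R),
    ex_derive_n (fun u => px (xi u)) n s /\
    ex_derive_n (fun u => py (xi u)) n s /\
    ex_derive_n (fun u => pz (xi u)) n s.

(* A curve in the unit sphere, defined on the nonempty open interval ]a, b[ and
   parametrized by arc length.  Only differentiability is required, so the
   curves of class C^k for every k >= 1, and the smooth ones, are included. *)
Definition spherical_curve (a b : Rbar) (xi : R -> vec3) : Prop :=
  Rbar_lt a b /\
  forall s, in_interval a b s ->
    euclid_norm (xi s) = 1 /\
    ex_velocity xi s /\
    euclid_norm (velocity xi s) = 1.

Definition z_nonconstant (a b : Rbar) (xi : R -> vec3) : Prop :=
  ~ exists c : R, forall s, in_interval a b s -> pz (xi s) = c.

Definition angular_momentum (xi : R -> vec3) (s : R) : R :=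
  - det3 (xi s) (velocity xi s) (0, 0, 1).

Definition has_angular_momentum
    (a b : Rbar) (xi : R -> vec3) (K : R -> R) : Prop :=
  forall s, in_interval a b s ->
    angular_momentum xi s = K (latitude (xi s)).

Definition arclength_parametrization (gamma V : R -> vec3) : Prop :=
  exists tau : R -> R,
    (forall s, ex_derive tau s /\ 0 < Derive tau s) /\
    (forall t, exists s, tau s = t) /\
    (forall s, V s = gamma (tau s)) /\
    (forall s, ex_velocity V s /\ euclid_norm (velocity V s) = 1).

(* Main.v *)
Require Import Defs.
From Stdlib Require Import Reals Lra.
From Coquelicot Require Import Coquelicot.
Open Scope R_scope.

(** For a unit-speed spherical curve, the prescribed momentum forces
    [z'^2 = (1 - z^2) / (2 - z^2)].  Since derivatives have the Darboux
    property, [z'] is continuous, and the signed radius [c = z' sqrt (2 - z^2)]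
    satisfies [c^2 + z^2 = 1]; it changes sign when the curve crosses a pole.
    Poles are isolated because the curve has unit speed, so
    [c' = - z / sqrt (2 - z^2)] holds everywhere.  Hence
    [(c, z) = (cos T, sin T)] with [T' = 1 / sqrt (1 + cos^2 T)], which is the
    equation of the angle of Viviani's curve as a function of arc length and
    determines [T] up to a shift of the parameter.  Finally [(x + i y) e^(-i T) / c]
    is locally constant off the poles, and it extends continuously across each
    pole because [x], [y] and [c] are differentiable there; so it is a constant
    [e^(i theta)], and [x + i y = e^(i theta) cos T e^(i T)]. *)

(** * Real functions of one variable *)


Lemma locally_Rabs (s : R) (P : R -> Prop) :
  locally s P <-> exists d, 0 < d /\ forall u, Rabs (u - s) < d -> P u.
Proof.
split.
- intros [d Hd]; exists d; split; [apply cond_pos|].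
  intros u Hu; apply Hd; exact Hu.
- intros [d [Hd H]]; exists (mkposreal d Hd); intros u Hu; apply H; exact Hu.
Qed.

Lemma is_derive_continuity_pt (f : R -> R) (s l : R) :
  is_derive f s l -> continuity_pt f s.
Proof.
intros H; apply continuity_pt_filterlim.
apply (ex_derive_continuous f s); exists l; exact H.
Qed.

(** By the mean value theorem the difference quotient at [s] is a value of [g] between [s] and
    [s + h], and it tends to [g s]. This carries a derivative known off an isolated pole over to the
    pole itself. *)
Lemma is_derive_removable (f g : R -> R) (s : R) :
  continuity_pt f s -> continuity_pt g s ->
  locally s (fun u => u <> s -> is_derive f u (g u)) ->
  is_derive f s (g s).
Proof.
intros Cf Cg Hd.
apply is_derive_Reals; intros eps Heps.
rewrite continuity_pt_locally in Cg.
generalize (filter_and _ _ Hd (Cg (mkposreal eps Heps))).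
intros H; apply locally_Rabs in H; destruct H as [d [Hd0 H]].
exists (mkposreal d Hd0); simpl; intros h Hh0 Hh.
assert (B : forall u, Rmin s (s + h) <= u <= Rmax s (s + h) ->
            Rabs (u - s) <= Rabs h).
{ intros u; unfold Rmin, Rmax, Rabs.
  destruct (Rle_dec s (s + h)); repeat destruct Rcase_abs; lra. }
destruct (MVT_gen f s (s + h) g) as [c [Hc E]].
- intros u Hu; apply H.
  + apply Rle_lt_trans with (2 := Hh); apply B; lra.
  + revert Hu; unfold Rmin, Rmax; destruct (Rle_dec s (s + h)); lra.
- intros u Hu; destruct (Req_dec u s) as [->|Hus]; [exact Cf|].
  apply is_derive_continuity_pt with (g u); apply H; [|exact Hus].
  apply Rle_lt_trans with (2 := Hh); apply B; lra.
- replace ((f (s + h) - f s) / h - g s) with (g c - g s).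
  + apply H; apply Rle_lt_trans with (2 := Hh); apply B; lra.
  + rewrite E; field; exact Hh0.
Qed.

(** If [df b] were negative, a maximum of [f] on the segment could lie at neither end, and at an
    interior maximum [df] would vanish. *)
Lemma derive_no_sign_change (f df : R -> R) (a b : R) :
  a < b -> (forall u, a <= u <= b -> is_derive f u (df u)) ->
  (forall u, a <= u <= b -> df u <> 0) -> 0 < df a -> 0 < df b.
Proof.
intros Hab Hd Hn Ha.
destruct (Rlt_le_dec 0 (df b)) as [H|H]; [exact H|exfalso].
assert (Hb : df b < 0) by (specialize (Hn b); lra); clear H.
destruct (continuity_ab_maj f a b) as [m [Hm Im]]; [lra| |].
{ intros c Hc; apply is_derive_continuity_pt with (df c); auto. }
assert (D : forall u, a <= u <= b -> derivable_pt_lim f u (df u)).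
{ intros u Hu; apply is_derive_Reals; auto. }
(* The positive derivative at [a] makes some [f (a + h)] exceed [f a]; the end [b] is excluded in
   the same way. *)
destruct (Req_dec m a) as [->|Hma].
{ destruct (D a) with (df a) as [d H]; [lra|exact Ha|].
  pose (h := Rmin (d / 2) (b - a)).
  assert (Hh : 0 < h <= d / 2 /\ h <= b - a).
  { destruct d as [d Hd0]; unfold h; simpl; repeat split;
    [apply Rmin_glb_lt; lra|apply Rmin_l|apply Rmin_r]. }
  specialize (H h); rewrite (Rabs_right h) in H by lra.
  destruct d as [d Hd0]; simpl in *.
  assert (K : Rabs ((f (a + h) - f a) / h - df a) < df a) by (apply H; lra).
  apply Rabs_def2 in K.
  specialize (Hm (a + h)).
  assert (0 < (f (a + h) - f a) / h * h) by (apply Rmult_lt_0_compat; lra).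
  replace ((f (a + h) - f a) / h * h) with (f (a + h) - f a) in * by (field; lra).
  lra. }
destruct (Req_dec m b) as [->|Hmb].
{ destruct (D b) with (- df b) as [d H]; [lra|lra|].
  pose (h := Rmin (d / 2) (b - a)).
  assert (Hh : 0 < h <= d / 2 /\ h <= b - a).
  { destruct d as [d Hd0]; unfold h; simpl; repeat split;
    [apply Rmin_glb_lt; lra|apply Rmin_l|apply Rmin_r]. }
  specialize (H (- h)); rewrite Rabs_Ropp, (Rabs_right h) in H by lra.
  destruct d as [d Hd0]; simpl in *.
  assert (K : Rabs ((f (b + - h) - f b) / - h - df b) < - df b) by (apply H; lra).
  apply Rabs_def2 in K.
  specialize (Hm (b + - h)).
  assert (0 < - ((f (b + - h) - f b) / - h) * h) by (apply Rmult_lt_0_compat; lra).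
  replace (- ((f (b + - h) - f b) / - h) * h) with (f (b + - h) - f b) in * by (field; lra).
  lra. }
assert (pr : derivable_pt f m) by (exists (df m); apply D; lra).
assert (E : derive_pt f m pr = 0).
{ apply (deriv_maximum f a b m pr); try lra; intros x H1 H2; apply Hm; lra. }
apply (Hn m); [lra|].
rewrite <- E; symmetry; apply derive_pt_eq_0; apply D; lra.
Qed.

Lemma locally_neq_0 (f : R -> R) (s : R) :
  continuity_pt f s -> f s <> 0 -> locally s (fun u => f u <> 0).
Proof.
intros C H; rewrite continuity_pt_locally in C.
generalize (C (mkposreal _ (Rabs_pos_lt _ H))); apply filter_imp; simpl.
intros u Hu E; rewrite E in Hu; rewrite Rminus_0_l, Rabs_Ropp in Hu; lra.
Qed.

(* Derivatives have the Darboux property, so only the sign of [df] could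
   obstruct its continuity. *)
Lemma derive_continuous_of_sqr (f df : R -> R) (s : R) :
  locally s (fun u => is_derive f u (df u)) ->
  continuity_pt (fun u => (df u) ^ 2) s -> continuity_pt df s.
Proof.
intros Hd C.
destruct (Req_dec (df s) 0) as [E|E].
- apply continuity_pt_locally; intros [e He].
  rewrite continuity_pt_locally in C.
  generalize (C (mkposreal _ (pow_lt e 2 He))); apply filter_imp; simpl; intros u.
  rewrite E; replace (df u * (df u * 1) - 0 * (0 * 1)) with (Rsqr (df u))
    by (unfold Rsqr; ring).
  rewrite Rminus_0_r, (Rabs_right (Rsqr _)) by (apply Rle_ge, Rle_0_sqr).
  replace (e * (e * 1)) with (Rsqr e) by (unfold Rsqr; ring).
  intros H; rewrite <- (Rabs_right e) by lra; apply Rsqr_lt_abs_0; exact H.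
- assert (N : locally s (fun u => (df u) ^ 2 <> 0)).
  { apply (locally_neq_0 (fun u => df u ^ 2)); [exact C|apply pow_nonzero; exact E]. }
  generalize (filter_and _ _ Hd N); clear Hd N; intros N.
  apply locally_Rabs in N; destruct N as [d [Hd0 N]].
  assert (D : forall u, Rabs (u - s) < d -> is_derive f u (df u)).
  { intros u Hu; apply N; exact Hu. }
  assert (Z : forall u, Rabs (u - s) < d -> df u <> 0).
  { intros u Hu E'; destruct (N u Hu) as [_ Z]; apply Z; rewrite E'; ring. }
  (* Scaling [f] by [df s] on the right of [s], and by [- df s] on the left (there by
     contradiction), makes the value at the left end positive, whatever the sign of [df s]. *)
  assert (S : forall u, Rabs (u - s) < d -> 0 < df s * df u).
  { intros u Hu.
    assert (B : forall v, Rmin s u <= v <= Rmax s u -> Rabs (v - s) < d).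
    { intros v; revert Hu; unfold Rmin, Rmax, Rabs.
      destruct (Rle_dec s u); repeat destruct Rcase_abs; lra. }
    destruct (Rtotal_order s u) as [H|[<-|H]].
    - rewrite Rmin_left, Rmax_right in B by lra.
      apply (derive_no_sign_change (fun v => df s * f v) (fun v => df s * df v) s u H).
      + intros v Hv; apply is_derive_scal; auto.
      + intros v Hv; apply Rmult_integral_contrapositive_currified; auto.
      + nra.
    - nra.
    - rewrite Rmin_right, Rmax_left in B by lra.
      apply Rnot_le_lt; intros K.
      assert (0 < - df s * df s).
      { apply (derive_no_sign_change (fun v => - df s * f v)
                 (fun v => - df s * df v) u s H).
        - intros v Hv; apply is_derive_scal; auto.
        - intros v Hv; apply Rmult_integral_contrapositive_currified; [lra|auto].
        - assert (df s * df u <> 0)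
            by (apply Rmult_integral_contrapositive_currified; auto).
          lra. }
      nra. }
  assert (P : 0 < Rabs (df s)) by (apply Rabs_pos_lt; exact E).
  apply continuity_pt_locally; intros [e He].
  rewrite continuity_pt_locally in C.
  assert (L : locally s (fun u => Rabs (u - s) < d)).
  { apply locally_Rabs; exists d; split; [exact Hd0|auto]. }
  generalize (filter_and _ _ L (C (mkposreal _ (Rmult_lt_0_compat _ _ He P)))).
  apply filter_imp; simpl; intros u [Hu K]; specialize (S u Hu).
  replace (df u * (df u * 1) - df s * (df s * 1))
    with ((df u - df s) * (df u + df s)) in K by ring.
  rewrite Rabs_mult in K.
  (* Equal signs bound the sum from below, so the difference of the squares controls the
     difference. *)
  assert (Rabs (df s) <= Rabs (df u + df s)).
  { unfold Rabs; repeat destruct Rcase_abs; nra. }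
  apply Rmult_lt_reg_r with (Rabs (df s)); [exact P|].
  apply Rle_lt_trans with (2 := K); apply Rmult_le_compat_l;
    [apply Rabs_pos|assumption].
Qed.

(** Near [s] the function [c] keeps its sign, so it is that constant sign times [sqrt (g u)], which
    can be differentiated because [g s] is positive. *)
Lemma is_derive_of_sqr (c g : R -> R) (s dg : R) :
  continuity_pt c s -> c s <> 0 ->
  locally s (fun u => (c u) ^ 2 = g u) -> is_derive g s dg ->
  is_derive c s (dg / (2 * c s)).
Proof.
intros C N Q D.
assert (G : g s = c s ^ 2) by (symmetry; exact (locally_singleton _ _ Q)).
assert (P : 0 < g s) by (rewrite G; nra).
assert (E : c s = c s / Rabs (c s) * sqrt (g s)).
{ rewrite G, <- Rsqr_pow2, sqrt_Rsqr_abs; field; apply Rabs_no_R0; exact N. }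
apply is_derive_ext_loc with (fun u => c s / Rabs (c s) * sqrt (g u)).
- rewrite continuity_pt_locally in C.
  generalize (filter_and _ _ Q (C (mkposreal _ (Rabs_pos_lt _ N)))).
  apply filter_imp; intros u [<- K]; simpl in K.
  rewrite <- Rsqr_pow2, sqrt_Rsqr_abs.
  change (@eq R (c s / Rabs (c s) * Rabs (c u)) (c u)).
  destruct (Rdichotomy _ _ N) as [S|S].
  + rewrite (Rabs_left (c s)) in K |- * by lra; apply Rabs_def2 in K.
    rewrite Rabs_left by lra; field; lra.
  + rewrite (Rabs_right (c s)) in K |- * by lra; apply Rabs_def2 in K.
    rewrite Rabs_right by lra; field; lra.
- auto_derive.
  + repeat split; [exists dg; exact D|exact P].
  + replace (Derive (fun u => g u) s) with dg
      by (symmetry; apply is_derive_unique; exact D).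
    assert (R : 0 < sqrt (g s)) by (apply sqrt_lt_R0; exact P).
    assert (A : Rabs (c s) = sqrt (g s))
      by (rewrite G, <- Rsqr_pow2, sqrt_Rsqr_abs; reflexivity).
    assert (A2 : sqrt (g s) * sqrt (g s) = c s * c s)
      by (rewrite sqrt_sqrt by lra; rewrite G; ring).
    rewrite A.
    transitivity (dg * c s / (2 * (sqrt (g s) * sqrt (g s)))); [field; lra|].
    rewrite A2; field; exact N.
Qed.

(* Caratheodory's difference quotient, completed by [l] at [s]. *)
Definition slope (f : R -> R) (s l u : R) : R :=
  if Req_dec_T u s then l else (f u - f s) / (u - s).

Lemma slope_at (f : R -> R) (s l : R) : slope f s l s = l.
Proof. unfold slope; destruct Req_dec_T; [reflexivity|lra]. Qed.

Lemma slope_eq (f : R -> R) (s l u : R) : f u = f s + slope f s l u * (u - s).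
Proof. unfold slope; destruct Req_dec_T as [->|]; field; lra. Qed.

Lemma slope_continuous (f : R -> R) (s l : R) :
  is_derive f s l -> continuity_pt (slope f s l) s.
Proof.
intros D; apply is_derive_Reals in D.
apply continuity_pt_locally; intros [e He]; simpl.
destruct (D e He) as [[d Hd] K]; simpl in K.
apply locally_Rabs; exists d; split; [exact Hd|]; intros u Hu.
rewrite slope_at; unfold slope; destruct Req_dec_T as [->|N].
- rewrite Rminus_diag, Rabs_R0; exact He.
- specialize (K (u - s)); replace (s + (u - s)) with u in K by ring.
  apply K; [lra|exact Hu].
Qed.

(** [f u] is [u - s] times a slope that is continuous at [s] with value [l], hence nonzero
    nearby. *)
Lemma simple_zero_isolated (f : R -> R) (s l : R) :
  is_derive f s l -> l <> 0 -> f s = 0 ->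
  locally s (fun u => u <> s -> f u <> 0).
Proof.
intros D N Z.
generalize (locally_neq_0 (slope f s l) s (slope_continuous _ _ _ D)).
rewrite slope_at; intros K; generalize (K N); apply filter_imp.
intros u Hu Hus; rewrite (slope_eq f s l u), Z, Rplus_0_l.
apply Rmult_integral_contrapositive_currified; [exact Hu|lra].
Qed.

(** * Open intervals, constancy and angles *)

Lemma in_interval_locally (a b : Rbar) (s : R) :
  in_interval a b s -> locally s (in_interval a b).
Proof.
intros H; apply (open_and _ _ (open_Rbar_gt a) (open_Rbar_lt b) s H).
Qed.

Lemma in_interval_convex (a b : Rbar) (s t u : R) :
  in_interval a b s -> in_interval a b t -> Rmin s t <= u <= Rmax s t ->
  in_interval a b u.
Proof.
unfold in_interval, Rmin, Rmax; intros [H1 H2] [H3 H4].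
destruct a, b; simpl in *; destruct (Rle_dec s t); intros; split; lra.
Qed.

Lemma derive_0_const (a b : Rbar) (f : R -> R) :
  (forall s, in_interval a b s -> is_derive f s 0) ->
  forall s t, in_interval a b s -> in_interval a b t -> f s = f t.
Proof.
intros D.
assert (L : forall s t, in_interval a b s -> in_interval a b t -> s < t -> f s = f t).
{ intros s t Hs Ht Hst; apply eq_is_derive; [|exact Hst].
  intros u Hu; apply D; apply (in_interval_convex a b s t); auto.
  rewrite Rmin_left, Rmax_right; lra. }
intros s t Hs Ht; destruct (Rtotal_order s t) as [H|[->|H]]; auto.
symmetry; auto.
Qed.

Lemma in_interval_inhabited (a b : Rbar) :
  Rbar_lt a b -> exists s, in_interval a b s.
Proof.
unfold in_interval; intros H.
destruct a as [a| |], b as [b| |]; simpl in *; try tauto.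
- exists ((a + b) / 2); lra.
- exists (a + 1); lra.
- exists (b - 1); lra.
- exists 0; tauto.
Qed.

Lemma unit_circle_angle (u v : R) :
  u ^ 2 + v ^ 2 = 1 -> exists t, cos t = u /\ sin t = v.
Proof.
intros H.
assert (B : -1 <= u <= 1) by nra.
assert (S : sqrt (1 - Rsqr u) = Rabs v).
{ replace (1 - Rsqr u) with (Rsqr v) by (unfold Rsqr; lra); apply sqrt_Rsqr_abs. }
destruct (Rle_lt_dec 0 v) as [Hv|Hv].
- exists (acos u); rewrite cos_acos, sin_acos, S, Rabs_right; lra.
- exists (- acos u); rewrite cos_neg, sin_neg, cos_acos, sin_acos, S, Rabs_left; lra.
Qed.

(** * Curves with the momentum of Viviani's curve *)


(** The last equation is the momentum condition with its sign reversed; [1 - z^2] replaces the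
    squared cosine of the latitude, so that no inverse sine remains. *)
Definition viviani_system (a b : Rbar) (x y z dx dy dz : R -> R) : Prop :=
  forall s, in_interval a b s ->
    (is_derive x s (dx s) /\ is_derive y s (dy s) /\ is_derive z s (dz s)) /\
    x s ^ 2 + y s ^ 2 + z s ^ 2 = 1 /\
    dx s ^ 2 + dy s ^ 2 + dz s ^ 2 = 1 /\
    x s * dy s - y s * dx s = (1 - z s ^ 2) / sqrt (2 - z s ^ 2).

Definition signed_radius (z dz : R -> R) (s : R) : R :=
  dz s * sqrt (2 - z s ^ 2).

Lemma system_orthogonal a b x y z dx dy dz :
  viviani_system a b x y z dx dy dz -> forall s, in_interval a b s ->
  x s * dx s + y s * dy s + z s * dz s = 0.
Proof.
intros H s Hs; destruct (H s Hs) as [[Dx [Dy Dz]] _].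
apply Rmult_eq_reg_l with 2; [rewrite Rmult_0_r|lra].
transitivity (Derive (fun u => x u ^ 2 + y u ^ 2 + z u ^ 2) s).
- symmetry; apply is_derive_unique; auto_derive.
  + repeat split; eexists; eassumption.
  + replace (Derive (fun u => x u) s) with (dx s)
      by (symmetry; apply is_derive_unique; exact Dx).
    replace (Derive (fun u => y u) s) with (dy s)
      by (symmetry; apply is_derive_unique; exact Dy).
    replace (Derive (fun u => z u) s) with (dz s)
      by (symmetry; apply is_derive_unique; exact Dz).
    ring.
- rewrite (Derive_ext_loc _ (fun _ => 1)); [apply Derive_const|].
  apply filter_imp with (2 := in_interval_locally a b s Hs).
  intros u Hu; apply (H u Hu).
Qed.

Lemma system_q_pos a b x y z dx dy dz :
  viviani_system a b x y z dx dy dz -> forall s, in_interval a b s ->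
  0 < sqrt (2 - z s ^ 2) /\ sqrt (2 - z s ^ 2) ^ 2 = 2 - z s ^ 2.
Proof.
intros H s Hs; destruct (H s Hs) as [_ [S _]].
assert (0 < 2 - z s ^ 2) by nra.
split; [apply sqrt_lt_R0; assumption|apply pow2_sqrt; lra].
Qed.

(** The planar Lagrange identity splits [(x^2 + y^2) (dx^2 + dy^2)] into a radial square, known by
    orthogonality, and the square of the momentum. The sphere and unit-speed equations then leave a
    relation between [z] and [dz] alone. *)
Lemma signed_radius_sqr a b x y z dx dy dz :
  viviani_system a b x y z dx dy dz -> forall s, in_interval a b s ->
  signed_radius z dz s ^ 2 = 1 - z s ^ 2.
Proof.
intros H s Hs; destruct (H s Hs) as [_ [S [U K]]].
assert (O := system_orthogonal _ _ _ _ _ _ _ _ H s Hs).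
destruct (system_q_pos _ _ _ _ _ _ _ _ H s Hs) as [Q0 Q2].
unfold signed_radius; set (q := sqrt (2 - z s ^ 2)) in *.
assert (L : (x s ^ 2 + y s ^ 2) * (dx s ^ 2 + dy s ^ 2)
  = (x s * dx s + y s * dy s) ^ 2 + (x s * dy s - y s * dx s) ^ 2) by ring.
rewrite K in L.
replace (x s ^ 2 + y s ^ 2) with (1 - z s ^ 2) in L by lra.
replace (dx s ^ 2 + dy s ^ 2) with (1 - dz s ^ 2) in L by lra.
replace (x s * dx s + y s * dy s) with (- (z s * dz s)) in L by lra.
assert (M : ((1 - z s ^ 2) / q) ^ 2 * q ^ 2 = (1 - z s ^ 2) ^ 2) by (field; lra).
rewrite Rpow_mult_distr.
replace (((1 - z s ^ 2) / q) ^ 2) with (1 - z s ^ 2 - dz s ^ 2) in M by lra.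
rewrite Q2 in *; lra.
Qed.

Lemma system_q_continuous a b x y z dx dy dz :
  viviani_system a b x y z dx dy dz -> forall s, in_interval a b s ->
  continuity_pt (fun u => sqrt (2 - z u ^ 2)) s.
Proof.
intros H s Hs; destruct (H s Hs) as [[_ [_ Dz]] _].
apply continuity_pt_filterlim.
apply (continuous_sqrt_comp (fun u => 2 - z u ^ 2)).
apply (ex_derive_continuous (fun u => 2 - z u ^ 2)).
auto_derive; eexists; exact Dz.
Qed.

(** Mere differentiability of the curve does not make [dz] continuous, but its square equals the
    continuous [(1 - z^2) / (2 - z^2)], and the Darboux property does the rest. *)
Lemma signed_radius_continuous a b x y z dx dy dz :
  viviani_system a b x y z dx dy dz -> forall s, in_interval a b s ->
  continuity_pt (signed_radius z dz) s.
Proof.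
intros H s Hs; destruct (H s Hs) as [[_ [_ Dz]] _].
apply (continuity_pt_mult dz (fun u => sqrt (2 - z u ^ 2)));
  [|exact (system_q_continuous _ _ _ _ _ _ _ _ H s Hs)].
apply (derive_continuous_of_sqr z).
- apply filter_imp with (2 := in_interval_locally a b s Hs).
  intros u Hu; apply (H u Hu).
- apply continuity_pt_ext_loc with (fun u => (1 - z u ^ 2) / (2 - z u ^ 2)).
  + apply filter_imp with (2 := in_interval_locally a b s Hs); intros u Hu.
    destruct (system_q_pos _ _ _ _ _ _ _ _ H u Hu) as [Q0 Q2].
    assert (W := signed_radius_sqr _ _ _ _ _ _ _ _ H u Hu).
    unfold signed_radius in W; rewrite Rpow_mult_distr, Q2 in W.
    assert (0 < 2 - z u ^ 2) by (rewrite <- Q2; apply pow_lt; exact Q0).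
    rewrite <- W; change (@eq R (dz u ^ 2 * (2 - z u ^ 2) / (2 - z u ^ 2)) (dz u ^ 2)).
    field; lra.
  + assert (0 < 2 - z s ^ 2).
    { destruct (system_q_pos _ _ _ _ _ _ _ _ H s Hs) as [Q0 Q2].
      rewrite <- Q2; apply pow_lt; exact Q0. }
    apply continuity_pt_filterlim.
    apply (ex_derive_continuous (fun u => (1 - z u ^ 2) / (2 - z u ^ 2))).
    auto_derive; repeat split; try (eexists; exact Dz); simpl in *; lra.
Qed.

(** Where the signed radius vanishes, [x], [y] and [dz] vanish too, so unit speed makes [dx] or [dy]
    nonzero. The corresponding coordinate has a simple zero there, and wherever it is nonzero so is
    the squared radius [x^2 + y^2]. *)
Lemma system_poles_isolated a b x y z dx dy dz :
  viviani_system a b x y z dx dy dz -> forall s, in_interval a b s ->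
  locally s (fun u => u <> s -> signed_radius z dz u <> 0).
Proof.
intros H s Hs; destruct (H s Hs) as [[Dx [Dy _]] [S [U _]]].
assert (W := signed_radius_sqr _ _ _ _ _ _ _ _ H).
destruct (Req_dec (signed_radius z dz s) 0) as [E|E].
- assert (Ez : dz s = 0).
  { destruct (system_q_pos _ _ _ _ _ _ _ _ H s Hs) as [Q0 _].
    unfold signed_radius in E; apply Rmult_integral in E; lra. }
  assert (Rs := W s Hs); rewrite E in Rs; rewrite Ez in U.
  assert (Ex : x s = 0) by nra; assert (Ey : y s = 0) by nra.
  assert (L : locally s (fun u => u <> s -> x u <> 0 \/ y u <> 0)).
  { destruct (Req_dec (dx s) 0) as [E1|E1].
    - assert (E2 : dy s <> 0) by (intros E2; rewrite E1, E2 in U; lra).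
      generalize (simple_zero_isolated y s _ Dy E2 Ey).
      apply filter_imp; auto.
    - generalize (simple_zero_isolated x s _ Dx E1 Ex).
      apply filter_imp; auto. }
  generalize (filter_and _ _ L (in_interval_locally a b s Hs)).
  apply filter_imp; intros u [Hu Iu] N F.
  specialize (W u Iu); rewrite F in W; destruct (H u Iu) as [_ [Su _]].
  destruct (Hu N) as [K|K]; apply K; nra.
- generalize (locally_neq_0 _ s (signed_radius_continuous _ _ _ _ _ _ _ _ H s Hs) E).
  apply filter_imp; auto.
Qed.

(** Off the poles, differentiating the square [1 - z^2] gives [- z dz / c]; the factor [dz]
    contained in [c] cancels, which leaves an expression that is continuous at the poles as well. *)
Lemma signed_radius_derive a b x y z dx dy dz :
  viviani_system a b x y z dx dy dz -> forall s, in_interval a b s ->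
  is_derive (signed_radius z dz) s (- z s / sqrt (2 - z s ^ 2)).
Proof.
intros H s Hs.
apply (is_derive_removable _ (fun u => - z u / sqrt (2 - z u ^ 2))).
- exact (signed_radius_continuous _ _ _ _ _ _ _ _ H s Hs).
- destruct (H s Hs) as [[_ [_ Dz]] _].
  apply (continuity_pt_div (fun u => - z u) (fun u => sqrt (2 - z u ^ 2))).
  + apply (continuity_pt_opp z), (is_derive_continuity_pt _ _ _ Dz).
  + exact (system_q_continuous _ _ _ _ _ _ _ _ H s Hs).
  + destruct (system_q_pos _ _ _ _ _ _ _ _ H s Hs); lra.
- generalize (filter_and _ _ (system_poles_isolated _ _ _ _ _ _ _ _ H s Hs)
                (in_interval_locally a b s Hs)).
  apply filter_imp; intros u [P Hu] N; specialize (P N).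
  destruct (H u Hu) as [[_ [_ Dz]] _].
  destruct (system_q_pos _ _ _ _ _ _ _ _ H u Hu) as [Q0 _].
  replace (- z u / sqrt (2 - z u ^ 2))
    with (- (2 * z u * dz u) / (2 * signed_radius z dz u)).
  + apply (is_derive_of_sqr _ (fun v => 1 - z v ^ 2)); auto.
    * exact (signed_radius_continuous _ _ _ _ _ _ _ _ H u Hu).
    * apply filter_imp with (2 := in_interval_locally a b u Hu).
      exact (signed_radius_sqr _ _ _ _ _ _ _ _ H).
    * auto_derive; [eexists; exact Dz|].
      replace (Derive (fun v => z v) u) with (dz u)
        by (symmetry; apply is_derive_unique; exact Dz).
      ring.
  + unfold signed_radius in *; field; split; [lra|].
    intros E; apply P; rewrite E; ring.
Qed.

(** The point [(c, z)] of the unit circle satisfies [c' = - z g] and [z' = c g], so it turns with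
    angular velocity [g], and its angle is a primitive of [g]. *)
Lemma system_phase a b x y z dx dy dz :
  Rbar_lt a b -> viviani_system a b x y z dx dy dz ->
  exists T : R -> R, forall s, in_interval a b s ->
    is_derive T s (/ sqrt (1 + cos (T s) ^ 2)) /\
    cos (T s) = signed_radius z dz s /\ sin (T s) = z s.
Proof.
intros Hab H; destruct (in_interval_inhabited a b Hab) as [s1 H1].
assert (W := signed_radius_sqr _ _ _ _ _ _ _ _ H).
destruct (unit_circle_angle (signed_radius z dz s1) (z s1)) as [t1 [C1 S1]].
{ specialize (W s1 H1); lra. }
(* Written with the given [z], the velocity makes [T] a plain integral. Once [cos (T s) = c s] is
   known, [2 - z^2 = 1 + c^2] turns this into the equation for [T] alone. *)
pose (g := fun u => / sqrt (2 - z u ^ 2)).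
pose (T := fun s => t1 + RInt g s1 s).
assert (Cg : forall s, in_interval a b s -> continuous g s).
{ intros s Hs; apply continuity_pt_filterlim.
  apply (continuity_pt_inv (fun u => sqrt (2 - z u ^ 2))).
  - exact (system_q_continuous _ _ _ _ _ _ _ _ H s Hs).
  - destruct (system_q_pos _ _ _ _ _ _ _ _ H s Hs); lra. }
assert (DT : forall s, in_interval a b s -> is_derive T s (g s)).
{ intros s Hs; unfold T.
  replace (g s) with (0 + g s) by ring.
  apply (is_derive_plus (fun _ => t1) (fun s => RInt g s1 s)); [auto_derive; auto|].
  apply (is_derive_RInt g _ s1); [|exact (Cg s Hs)].
  apply filter_imp with (2 := in_interval_locally a b s Hs).
  intros u Hu; apply (RInt_correct g s1 u), ex_RInt_continuous.
  intros v Hv; apply Cg; exact (in_interval_convex _ _ _ _ _ H1 Hu Hv). }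
pose (c := signed_radius z dz).
assert (Dc : forall s, in_interval a b s -> is_derive c s (- z s * g s)).
{ exact (signed_radius_derive _ _ _ _ _ _ _ _ H). }
assert (Dz : forall s, in_interval a b s -> is_derive z s (c s * g s)).
{ intros s Hs; destruct (system_q_pos _ _ _ _ _ _ _ _ H s Hs).
  replace (c s * g s) with (dz s); [apply (H s Hs)|].
  unfold c, g, signed_radius; field; lra. }
(* These are the real and imaginary parts of [(c + i z) e^(-i T)]. Both have derivative zero, and at
   [s1] they are 1 and 0 by the choice of [t1]. *)
assert (K : forall s, in_interval a b s ->
  c s * cos (T s) + z s * sin (T s) = 1 /\ z s * cos (T s) - c s * sin (T s) = 0).
{ assert (E1 : T s1 = t1) by (unfold T; rewrite RInt_point; apply Rplus_0_r).
  intros s Hs; split.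
  - transitivity (c s1 * cos (T s1) + z s1 * sin (T s1)).
    + apply (derive_0_const a b (fun s => c s * cos (T s) + z s * sin (T s)));
        auto; intros u Hu.
      auto_derive; [repeat split; eexists; eauto|].
      replace (Derive (fun v => c v) u) with (- z u * g u)
        by (symmetry; apply is_derive_unique; auto).
      replace (Derive (fun v => z v) u) with (c u * g u)
        by (symmetry; apply is_derive_unique; auto).
      replace (Derive (fun v => T v) u) with (g u)
        by (symmetry; apply is_derive_unique; auto).
      ring.
    + rewrite E1, C1, S1; specialize (W s1 H1); fold c in W |- *; nra.
  - transitivity (z s1 * cos (T s1) - c s1 * sin (T s1)).
    + apply (derive_0_const a b (fun s => z s * cos (T s) - c s * sin (T s)));
        auto; intros u Hu.
      auto_derive; [repeat split; eexists; eauto|].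
      replace (Derive (fun v => c v) u) with (- z u * g u)
        by (symmetry; apply is_derive_unique; auto).
      replace (Derive (fun v => z v) u) with (c u * g u)
        by (symmetry; apply is_derive_unique; auto).
      replace (Derive (fun v => T v) u) with (g u)
        by (symmetry; apply is_derive_unique; auto).
      ring.
    + rewrite E1, C1, S1; unfold c; ring. }
exists T; intros s Hs; destruct (K s Hs) as [K1 K2]; specialize (W s Hs).
fold c in W |- *.
assert (P : sin (T s) ^ 2 + cos (T s) ^ 2 = 1)
  by (rewrite <- !Rsqr_pow2; apply sin2_cos2).
assert (Ec : cos (T s) = c s).
{ transitivity (cos (T s) * (c s * cos (T s) + z s * sin (T s))
    - sin (T s) * (z s * cos (T s) - c s * sin (T s))); [rewrite K1, K2; ring|].
  transitivity (c s * (sin (T s) ^ 2 + cos (T s) ^ 2)); [ring|rewrite P; ring]. }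
assert (Es : sin (T s) = z s).
{ transitivity (sin (T s) * (c s * cos (T s) + z s * sin (T s))
    + cos (T s) * (z s * cos (T s) - c s * sin (T s))); [rewrite K1, K2; ring|].
  transitivity (z s * (sin (T s) ^ 2 + cos (T s) ^ 2)); [ring|rewrite P; ring]. }
split; [|split; assumption].
replace (1 + cos (T s) ^ 2) with (2 - z s ^ 2); [exact (DT s Hs)|].
rewrite Ec, W; ring.
Qed.

(** In complex form the conclusion is [x + i y = c (c + i z) e^(i theta)], free of division by [c]
    and so meaningful at the poles. Off the poles both [x + i y] and [c (c + i z)] have the
    logarithmic derivative [i / q - z / (q c)], where [q = sqrt (2 - z^2)]. *)
Lemma system_longitude a b x y z dx dy dz :
  Rbar_lt a b -> viviani_system a b x y z dx dy dz ->
  exists theta, forall s, in_interval a b s ->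
    let c := signed_radius z dz s in
    x s = c * (c * cos theta - z s * sin theta) /\
    y s = c * (z s * cos theta + c * sin theta).
Proof.
intros Hab H; destruct (in_interval_inhabited a b Hab) as [s1 H1].
assert (W := signed_radius_sqr _ _ _ _ _ _ _ _ H).
set (c := signed_radius z dz) in *.
(* Off the poles, [h1 + i h2 = (x + i y) (c - i z) / c]; at a pole the value is
   the quotient of the derivatives of numerator and denominator. *)
pose (h1 := fun s => if Req_dec_T (c s) 0 then - dy s else x s + y s * z s / c s).
pose (h2 := fun s => if Req_dec_T (c s) 0 then dx s else y s - x s * z s / c s).
assert (Pole : forall s, in_interval a b s -> c s = 0 ->
  x s = 0 /\ y s = 0 /\ dz s = 0 /\ z s ^ 2 = 1).
{ intros s Hs E; destruct (H s Hs) as [_ [S _]].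
  destruct (system_q_pos _ _ _ _ _ _ _ _ H s Hs) as [Q0 _].
  specialize (W s Hs); rewrite E in W.
  unfold c, signed_radius in E; apply Rmult_integral in E.
  repeat split; try nra; destruct E; lra. }
assert (D : forall s, in_interval a b s -> c s <> 0 ->
  is_derive h1 s 0 /\ is_derive h2 s 0).
{ intros s Hs E; destruct (H s Hs) as [[Dx [Dy Dz]] [S [_ K]]].
  assert (O := system_orthogonal _ _ _ _ _ _ _ _ H s Hs).
  destruct (system_q_pos _ _ _ _ _ _ _ _ H s Hs) as [Q0 _].
  assert (Dc := signed_radius_derive _ _ _ _ _ _ _ _ H s Hs).
  assert (Zc : c s = dz s * sqrt (2 - z s ^ 2)) by reflexivity.
  assert (N := locally_neq_0 c s (is_derive_continuity_pt _ _ _ Dc) E).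
  fold c in Dc; specialize (W s Hs).
  set (q := sqrt (2 - z s ^ 2)) in *.
  assert (Edz : dz s = c s / q) by (rewrite Zc; field; lra).
  (* Orthogonality and the momentum equation form a linear system for [dx] and [dy] with determinant
     [x^2 + y^2 = c^2], solved here by Cramer's rule. *)
  assert (X : dx s = - (x s * z s + y s * c s) / (q * c s)).
  { assert (F : c s ^ 2 * dx s = - x s * (z s * dz s) - y s * ((1 - z s ^ 2) / q)).
    { rewrite <- K; replace (z s * dz s) with (- (x s * dx s + y s * dy s)) by lra.
      rewrite W; replace (1 - z s ^ 2) with (x s ^ 2 + y s ^ 2) by lra; ring. }
    apply Rmult_eq_reg_l with (c s ^ 2); [|apply pow_nonzero; exact E].
    rewrite F, <- W, Edz; field; lra. }
  assert (Y : dy s = (x s * c s - y s * z s) / (q * c s)).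
  { assert (F : c s ^ 2 * dy s = - y s * (z s * dz s) + x s * ((1 - z s ^ 2) / q)).
    { rewrite <- K; replace (z s * dz s) with (- (x s * dx s + y s * dy s)) by lra.
      rewrite W; replace (1 - z s ^ 2) with (x s ^ 2 + y s ^ 2) by lra; ring. }
    apply Rmult_eq_reg_l with (c s ^ 2); [|apply pow_nonzero; exact E].
    rewrite F, <- W, Edz; field; lra. }
  split.
  - apply is_derive_ext_loc with (fun u => x u + y u * z u / c u).
    + generalize N; apply filter_imp; intros u Hu.
      unfold h1; destruct Req_dec_T; [tauto|reflexivity].
    + auto_derive; [repeat split; try (eexists; eassumption); exact E|].
      replace (Derive (fun u => x u) s) with (dx s)
        by (symmetry; apply is_derive_unique; exact Dx).
      replace (Derive (fun u => y u) s) with (dy s)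
        by (symmetry; apply is_derive_unique; exact Dy).
      replace (Derive (fun u => z u) s) with (dz s)
        by (symmetry; apply is_derive_unique; exact Dz).
      replace (Derive (fun u => c u) s) with (- z s / q)
        by (symmetry; apply is_derive_unique; exact Dc).
      rewrite X, Y, Edz; field; lra.
  - apply is_derive_ext_loc with (fun u => y u - x u * z u / c u).
    + generalize N; apply filter_imp; intros u Hu.
      unfold h2; destruct Req_dec_T; [tauto|reflexivity].
    + auto_derive; [repeat split; try (eexists; eassumption); exact E|].
      replace (Derive (fun u => x u) s) with (dx s)
        by (symmetry; apply is_derive_unique; exact Dx).
      replace (Derive (fun u => y u) s) with (dy s)
        by (symmetry; apply is_derive_unique; exact Dy).
      replace (Derive (fun u => z u) s) with (dz s)
        by (symmetry; apply is_derive_unique; exact Dz).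
      replace (Derive (fun u => c u) s) with (- z s / q)
        by (symmetry; apply is_derive_unique; exact Dc).
      rewrite X, Y, Edz; field; lra. }
(* At a pole [x], [y] and [c] all vanish while [c'] does not, so [y / c] and [x / c] extend
   continuously as quotients of slopes. *)
assert (C : forall s, in_interval a b s -> c s = 0 ->
  continuity_pt h1 s /\ continuity_pt h2 s).
{ intros s Hs E; destruct (H s Hs) as [[Dx [Dy Dz]] _].
  destruct (Pole s Hs E) as [Ex [Ey [_ Ez]]].
  assert (Dc := signed_radius_derive _ _ _ _ _ _ _ _ H s Hs); fold c in Dc.
  (* At a pole [z^2 = 1], so [c' = - z] is nonzero there. *)
  replace (sqrt (2 - z s ^ 2)) with 1 in Dc
    by (rewrite Ez, <- sqrt_1 at 1; f_equal; ring).
  assert (Nz : z s <> 0) by (intros F; rewrite F in Ez; lra).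
  assert (Cx := is_derive_continuity_pt _ _ _ Dx).
  assert (Cy := is_derive_continuity_pt _ _ _ Dy).
  assert (Cz := is_derive_continuity_pt _ _ _ Dz).
  assert (Sx := slope_continuous _ _ _ Dx).
  assert (Sy := slope_continuous _ _ _ Dy).
  assert (Sc := slope_continuous _ _ _ Dc).
  assert (Nc : slope c s (- z s / 1) s <> 0) by (rewrite slope_at; lra).
  assert (P := system_poles_isolated _ _ _ _ _ _ _ _ H s Hs); fold c in P.
  assert (Q : forall f l u, f s = 0 -> u <> s -> c u <> 0 ->
    slope f s l u / slope c s (- z s / 1) u = f u / c u).
  { intros f l u Ef Hu Hc; unfold slope.
    destruct Req_dec_T; [tauto|]; rewrite Ef, E; field; split; lra. }
  split.
  - apply continuity_pt_ext_loc with
      (fun u => x u + slope y s (dy s) u / slope c s (- z s / 1) u * z u).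
    + generalize P; apply filter_imp; intros u Hu.
      destruct (Req_dec u s) as [->|N].
      (* The slopes at the pole are [dy s] and [- z s], which explains the value [- dy s] chosen for
         [h1]. *)
      * rewrite !slope_at, Ex; unfold h1; destruct Req_dec_T; [|tauto].
        change (@eq R (0 + dy s / (- z s / 1) * z s) (- dy s)); field; exact Nz.
      * specialize (Hu N); rewrite (Q y (dy s) u Ey N Hu); unfold h1.
        destruct Req_dec_T; [tauto|].
        change (@eq R (x u + y u / c u * z u) (x u + y u * z u / c u)).
        field; exact Hu.
    + apply (continuity_pt_plus x); [exact Cx|].
      apply (continuity_pt_mult (fun u => slope y s (dy s) u / slope c s (- z s / 1) u));
        [|exact Cz].
      apply (continuity_pt_div (slope y s (dy s)) (slope c s (- z s / 1))); assumption.
  - apply continuity_pt_ext_loc with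
      (fun u => y u - slope x s (dx s) u / slope c s (- z s / 1) u * z u).
    + generalize P; apply filter_imp; intros u Hu.
      destruct (Req_dec u s) as [->|N].
      * rewrite !slope_at, Ey; unfold h2; destruct Req_dec_T; [|tauto].
        change (@eq R (0 - dx s / (- z s / 1) * z s) (dx s)); field; exact Nz.
      * specialize (Hu N); rewrite (Q x (dx s) u Ex N Hu); unfold h2.
        destruct Req_dec_T; [tauto|].
        change (@eq R (y u - x u / c u * z u) (y u - x u * z u / c u)).
        field; exact Hu.
    + apply (continuity_pt_minus y); [exact Cy|].
      apply (continuity_pt_mult (fun u => slope x s (dx s) u / slope c s (- z s / 1) u));
        [|exact Cz].
      apply (continuity_pt_div (slope x s (dx s)) (slope c s (- z s / 1))); assumption. }
assert (D0 : forall s, in_interval a b s -> is_derive h1 s 0 /\ is_derive h2 s 0).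
{ intros s Hs; destruct (Req_dec (c s) 0) as [E|E]; [|exact (D s Hs E)].
  assert (L := filter_and _ _ (system_poles_isolated _ _ _ _ _ _ _ _ H s Hs)
                 (in_interval_locally a b s Hs)).
  destruct (C s Hs E) as [C1 C2].
  split.
  - apply (is_derive_removable h1 (fun _ => 0)); auto.
    + apply continuity_pt_const; intros ? ?; reflexivity.
    + generalize L; apply filter_imp; intros u [P Hu] N; apply (D u Hu (P N)).
  - apply (is_derive_removable h2 (fun _ => 0)); auto.
    + apply continuity_pt_const; intros ? ?; reflexivity.
    + generalize L; apply filter_imp; intros u [P Hu] N; apply (D u Hu (P N)). }
(* The constant [h1 + i h2] has modulus one: by unit speed with [dz = 0] if [s1] is a pole, and by
   [x^2 + y^2 = c^2] otherwise. *)
destruct (unit_circle_angle (h1 s1) (h2 s1)) as [theta [Ct St]].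
{ destruct (H s1 H1) as [_ [S [U _]]]; unfold h1, h2.
  destruct Req_dec_T as [E|E].
  - destruct (Pole s1 H1 E) as [_ [_ [Ez _]]]; rewrite Ez in U; lra.
  - specialize (W s1 H1).
    transitivity ((x s1 ^ 2 + y s1 ^ 2) * (c s1 ^ 2 + z s1 ^ 2) / c s1 ^ 2);
      [field; exact E|].
    replace (x s1 ^ 2 + y s1 ^ 2) with (c s1 ^ 2) by lra.
    rewrite W at 2; field; exact E. }
exists theta; intros s Hs; cbv zeta; fold c.
change (signed_radius z dz s) with (c s).
rewrite Ct, St.
rewrite (derive_0_const a b h1 (fun u Hu => proj1 (D0 u Hu)) s1 s H1 Hs).
rewrite (derive_0_const a b h2 (fun u Hu => proj2 (D0 u Hu)) s1 s H1 Hs).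
unfold h1, h2; destruct Req_dec_T as [E|E].
- destruct (Pole s Hs E) as [Ex [Ey _]]; rewrite Ex, Ey, E; lra.
- specialize (W s Hs); assert (F : z s ^ 2 = 1 - c s ^ 2) by lra.
  split.
  + transitivity (x s * (c s ^ 2 + z s ^ 2)); [rewrite F; ring|field; exact E].
  + transitivity (y s * (c s ^ 2 + z s ^ 2)); [rewrite F; ring|field; exact E].
Qed.

(** * Arc length of Viviani's curve *)


(** Norm of [(- sin 2t, cos 2t, cos t)], the derivative of [viviani] in its angle. *)
Definition viviani_speed (t : R) : R := sqrt (1 + cos t ^ 2).

(** As [1 + cos^2 = 2 - sin^2], this is [sqrt 2] times the incomplete elliptic integral of the
    second kind with parameter 1/2; its inverse is therefore obtained abstractly. *)
Definition viviani_arc (t : R) : R := RInt viviani_speed 0 t.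

Lemma viviani_speed_ge_1 (t : R) : 1 <= viviani_speed t.
Proof.
unfold viviani_speed; rewrite <- sqrt_1 at 1; apply sqrt_le_1_alt.
generalize (pow2_ge_0 (cos t)); lra.
Qed.

Lemma viviani_speed_derive (t : R) :
  is_derive viviani_speed t (- (cos t * sin t) / viviani_speed t).
Proof.
assert (P := pow2_ge_0 (cos t)); assert (S := viviani_speed_ge_1 t).
unfold viviani_speed in *; auto_derive; [simpl in P; lra|].
simpl in S |- *; field; simpl; lra.
Qed.

Lemma viviani_arc_derive (t : R) : is_derive viviani_arc t (viviani_speed t).
Proof.
assert (C : forall u, continuous viviani_speed u).
{ intros u; apply (ex_derive_continuous viviani_speed).
  eexists; apply viviani_speed_derive. }
apply (is_derive_RInt viviani_speed _ 0); [|apply C].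
apply filter_forall; intros u; apply (RInt_correct viviani_speed 0 u).
apply ex_RInt_continuous; intros; apply C.
Qed.

Lemma viviani_arc_MVT (s t : R) :
  exists c, Rmin s t <= c <= Rmax s t /\
    viviani_arc t - viviani_arc s = viviani_speed c * (t - s).
Proof.
apply (MVT_gen viviani_arc).
- intros; apply viviani_arc_derive.
- intros u _; apply (is_derive_continuity_pt _ _ _ (viviani_arc_derive u)).
Qed.

Lemma viviani_arc_expanding (s t : R) :
  Rabs (t - s) <= Rabs (viviani_arc t - viviani_arc s).
Proof.
destruct (viviani_arc_MVT s t) as [c [_ ->]].
rewrite Rabs_mult, <- (Rmult_1_l (Rabs (t - s))) at 1.
apply Rmult_le_compat_r; [apply Rabs_pos|].
apply Rle_trans with (2 := Rle_abs _), viviani_speed_ge_1.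
Qed.

Lemma viviani_arc_inj (s t : R) : viviani_arc s = viviani_arc t -> s = t.
Proof.
intros E; generalize (viviani_arc_expanding s t).
rewrite E, Rminus_diag, Rabs_R0; intros H.
destruct (Req_dec (t - s) 0) as [Z|Z]; [lra|].
generalize (Rabs_pos_lt _ Z); lra.
Qed.

(** Since the speed is at least 1, the values at [- Rabs s] and [Rabs s] enclose [s], and the
    intermediate value theorem applies. The informative existential lets the inverse be defined by
    projection. *)
Lemma viviani_arc_surj (s : R) : {t : R | viviani_arc t = s}.
Proof.
assert (Z : viviani_arc 0 = 0) by exact (RInt_point 0 viviani_speed).
assert (B : Rmin (viviani_arc (- Rabs s)) (viviani_arc (Rabs s)) <= s
            <= Rmax (viviani_arc (- Rabs s)) (viviani_arc (Rabs s))).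
{ assert (L := Rabs_pos s).
  destruct (viviani_arc_MVT 0 (Rabs s)) as [c [_ Ec]].
  destruct (viviani_arc_MVT 0 (- Rabs s)) as [d [_ Ed]].
  assert (Pc := viviani_speed_ge_1 c); assert (Pd := viviani_speed_ge_1 d).
  rewrite Z in Ec, Ed.
  assert (viviani_arc (- Rabs s) <= - Rabs s) by nra.
  assert (Rabs s <= viviani_arc (Rabs s)) by nra.
  assert (- Rabs s <= s <= Rabs s)
    by (split; [generalize (Rle_abs (- s)); rewrite Rabs_Ropp; lra|apply Rle_abs]).
  rewrite Rmin_left, Rmax_right; lra. }
destruct (fun C => IVT_gen viviani_arc _ _ s C B) as [t [_ Ht]].
- intros u; apply (is_derive_continuity_pt _ _ _ (viviani_arc_derive u)).
- exists t; exact Ht.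
Qed.

Definition viviani_angle (s : R) : R := proj1_sig (viviani_arc_surj s).

Lemma viviani_arcK (s : R) : viviani_arc (viviani_angle s) = s.
Proof. unfold viviani_angle; destruct viviani_arc_surj; assumption. Qed.

(** The mean value theorem for the arc makes the difference quotient equal to [/ viviani_speed c],
    and the expansion inequality keeps [c] within [Rabs h] of the angle at [s]. *)
Lemma viviani_angle_derive (s : R) :
  is_derive viviani_angle s (/ viviani_speed (viviani_angle s)).
Proof.
apply is_derive_Reals; intros e He.
assert (C : continuity_pt (fun t => / viviani_speed t) (viviani_angle s)).
{ apply (continuity_pt_inv viviani_speed).
  - exact (is_derive_continuity_pt _ _ _ (viviani_speed_derive _)).
  - generalize (viviani_speed_ge_1 (viviani_angle s)); lra. }
rewrite continuity_pt_locally in C.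
assert (L := C (mkposreal e He)); apply locally_Rabs in L.
destruct L as [d [Hd L]]; simpl in L.
exists (mkposreal d Hd); simpl; intros h Hh0 Hh.
destruct (viviani_arc_MVT (viviani_angle s) (viviani_angle (s + h)))
  as [c [Hc E]].
assert (X := viviani_arc_expanding (viviani_angle s) (viviani_angle (s + h))).
rewrite !viviani_arcK in E, X; replace (s + h - s) with h in E, X by ring.
assert (P := viviani_speed_ge_1 c).
replace ((viviani_angle (s + h) - viviani_angle s) / h)
  with (/ viviani_speed c).
- apply L; apply Rle_lt_trans with (2 := Hh), Rle_trans with (2 := X).
  revert Hc; unfold Rmin, Rmax, Rabs.
  destruct Rle_dec; repeat destruct Rcase_abs; lra.
- apply Rmult_eq_reg_l with (viviani_speed c * h);
    [|apply Rmult_integral_contrapositive_currified; lra].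
  transitivity h; [field; lra|].
  rewrite E at 1; field; exact Hh0.
Qed.

(** The left side is [(dt * viviani_speed t)^2], and positivity of [dt] selects the root. One
    direction builds a unit-speed parametrization, the other identifies [tau'] in a given one. *)
Lemma viviani_unit_speed (t dt : R) :
  0 < dt ->
  (- 2 * cos t * sin t * dt) ^ 2 + ((cos t ^ 2 - sin t ^ 2) * dt) ^ 2
    + (cos t * dt) ^ 2 = 1 <-> dt = / viviani_speed t.
Proof.
intros P.
assert (T : cos t ^ 2 + sin t ^ 2 = 1)
  by (rewrite Rplus_comm, <- !Rsqr_pow2; apply sin2_cos2).
assert (S := viviani_speed_ge_1 t).
assert (S2 : viviani_speed t ^ 2 = 1 + cos t ^ 2)
  by (apply pow2_sqrt; generalize (pow2_ge_0 (cos t)); lra).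
replace ((- 2 * cos t * sin t * dt) ^ 2 + ((cos t ^ 2 - sin t ^ 2) * dt) ^ 2
    + (cos t * dt) ^ 2) with ((dt * viviani_speed t) ^ 2).
- split; intros E.
  + assert (0 < dt * viviani_speed t) by (apply Rmult_lt_0_compat; lra).
    assert (dt * viviani_speed t = 1) by nra.
    apply Rmult_eq_reg_r with (viviani_speed t); [|lra].
    rewrite Rinv_l; lra.
  + rewrite E; field; lra.
- rewrite Rpow_mult_distr, S2.
  transitivity (dt ^ 2 * ((cos t ^ 2 + sin t ^ 2) ^ 2 + cos t ^ 2)); [rewrite T|]; ring.
Qed.

(** * Unit-speed parametrizations of Viviani's curve *)

Lemma euclid_norm_1 (p : vec3) :
  euclid_norm p = 1 <-> px p ^ 2 + py p ^ 2 + pz p ^ 2 = 1.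
Proof.
unfold euclid_norm; split; intros E.
- assert (P : 0 <= px p ^ 2 + py p ^ 2 + pz p ^ 2).
  { generalize (pow2_ge_0 (px p)) (pow2_ge_0 (py p)) (pow2_ge_0 (pz p)); lra. }
  rewrite <- (pow2_sqrt _ P), E; ring.
- rewrite E; apply sqrt_1.
Qed.

Lemma velocity_unique (xi : R -> vec3) (s lx ly lz : R) :
  is_derive (fun u => px (xi u)) s lx -> is_derive (fun u => py (xi u)) s ly ->
  is_derive (fun u => pz (xi u)) s lz -> velocity xi s = (lx, ly, lz).
Proof.
intros Dx Dy Dz; unfold velocity.
f_equal; [f_equal|]; apply is_derive_unique; assumption.
Qed.

Lemma viviani_reparam_derive (V : R -> vec3) (tau : R -> R) (s dt : R) :
  (forall u, V u = viviani (tau u)) -> is_derive tau s dt ->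
  ex_velocity V s /\
  velocity V s = (- 2 * cos (tau s) * sin (tau s) * dt,
    (cos (tau s) ^ 2 - sin (tau s) ^ 2) * dt, cos (tau s) * dt).
Proof.
intros E D.
assert (H : is_derive (fun u => px (V u)) s (- 2 * cos (tau s) * sin (tau s) * dt) /\
  is_derive (fun u => py (V u)) s ((cos (tau s) ^ 2 - sin (tau s) ^ 2) * dt) /\
  is_derive (fun u => pz (V u)) s (cos (tau s) * dt)).
{ split; [|split];
    [apply (is_derive_ext (fun u => cos (tau u) * cos (tau u)))
    |apply (is_derive_ext (fun u => cos (tau u) * sin (tau u)))
    |apply (is_derive_ext (fun u => sin (tau u)))];
    try (intros u; rewrite E; reflexivity);
    (auto_derive; [repeat apply conj; try (eexists; exact D); exact I|]);
    replace (Derive (fun u => tau u) s) with dt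
      by (symmetry; apply is_derive_unique; exact D); ring. }
destruct H as [Dx [Dy Dz]]; split.
- split; [|split]; eexists; eassumption.
- exact (velocity_unique _ _ _ _ _ Dx Dy Dz).
Qed.

Lemma viviani_arclength_ex :
  arclength_parametrization viviani (fun s => viviani (viviani_angle s)).
Proof.
assert (P : forall t, 0 < / viviani_speed t).
{ intros t; apply Rinv_0_lt_compat; generalize (viviani_speed_ge_1 t); lra. }
exists viviani_angle; split; [|split; [|split; [reflexivity|]]].
- intros s; assert (D := viviani_angle_derive s); split.
  + eexists; exact D.
  + rewrite (is_derive_unique _ _ _ D); apply P.
- intros t; exists (viviani_arc t); apply viviani_arc_inj, viviani_arcK.
- intros s.
  destruct (viviani_reparam_derive (fun s => viviani (viviani_angle s)) _ s _
    (fun u => eq_refl) (viviani_angle_derive s)) as [X Ev].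
  split.
  + exact X.
  + apply euclid_norm_1; rewrite Ev.
    unfold px, py, pz; simpl fst; simpl snd.
    apply viviani_unit_speed; [apply P|reflexivity].
Qed.

(** Unit speed and the positive orientation of [tau] force the same autonomous equation that the
    phase [T] of an arbitrary solution satisfies. *)
Lemma viviani_arclength_tau (V : R -> vec3) :
  arclength_parametrization viviani V ->
  exists tau, (forall s, is_derive tau s (/ viviani_speed (tau s))) /\
    (forall t, exists s, tau s = t) /\ (forall s, V s = viviani (tau s)).
Proof.
intros [tau [Ht [St [E N]]]]; exists tau; split; [|split; assumption].
intros s; destruct (Ht s) as [D P]; apply Derive_correct in D.
replace (/ viviani_speed (tau s)) with (Derive tau s); [exact D|].
apply viviani_unit_speed; [exact P|].
destruct (viviani_reparam_derive V tau s _ E D) as [_ Ev].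
destruct (N s) as [_ U]; apply euclid_norm_1 in U; rewrite Ev in U; exact U.
Qed.

(** * Smoothness *)

Lemma ex_derive_n_of_closed (A : (R -> R) -> Prop) :
  (forall f, A f -> exists g, A g /\ forall s, is_derive f s (g s)) ->
  forall f, A f -> forall n s, ex_derive_n f n s.
Proof.
intros C f Hf.
assert (K : forall n, exists g, A g /\ forall s, Derive_n f n s = g s).
{ induction n as [|n [g [Hg E]]]; [exists f; auto|].
  destruct (C g Hg) as [h [Hh D]]; exists h; split; [exact Hh|].
  intros s; simpl; rewrite (Derive_ext _ g s E).
  apply is_derive_unique, D. }
intros [|n] s; [exact I|simpl].
destruct (K n) as [g [Hg E]]; destruct (C g Hg) as [h [_ D]].
apply ex_derive_ext with g; [intros u; symmetry; apply E|].
exists (h s); apply D.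
Qed.

(* The algebra generated by the components of the curve and the inverse speed
   is closed under differentiation, which gives smoothness. *)
Inductive viviani_algebra (tau : R -> R) : (R -> R) -> Prop :=
| va_const c : viviani_algebra tau (fun _ => c)
| va_cos : viviani_algebra tau (fun s => cos (tau s))
| va_sin : viviani_algebra tau (fun s => sin (tau s))
| va_inv : viviani_algebra tau (fun s => / viviani_speed (tau s))
| va_plus f g : viviani_algebra tau f -> viviani_algebra tau g ->
    viviani_algebra tau (fun s => f s + g s)
| va_mult f g : viviani_algebra tau f -> viviani_algebra tau g ->
    viviani_algebra tau (fun s => f s * g s).

Lemma viviani_algebra_derive (tau : R -> R) :
  (forall s, is_derive tau s (/ viviani_speed (tau s))) ->
  forall f, viviani_algebra tau f ->
    exists g, viviani_algebra tau g /\ forall s, is_derive f s (g s).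
Proof.
intros Dt.
assert (Et : forall s, Derive (fun u => tau u) s = / viviani_speed (tau s))
  by (intros s; apply is_derive_unique, Dt).
pose (k := fun s => / viviani_speed (tau s)).
assert (Ak : viviani_algebra tau k) by apply va_inv.
induction 1 as [c| | | |f g Hf [f' [Af Df]] Hg [g' [Ag Dg]]
                       |f g Hf [f' [Af Df]] Hg [g' [Ag Dg]]].
- exists (fun _ => 0); split; [apply va_const|intros s; apply (is_derive_const c s)].
- exists (fun s => -1 * (sin (tau s) * k s)); split.
  { repeat first [apply (va_mult tau (fun _ => -1)) | apply (va_mult tau _ k)];
      auto using va_const, va_sin. }
  intros s; auto_derive; [eexists; apply Dt|rewrite Et; unfold k; ring].
- exists (fun s => cos (tau s) * k s); split.
  { apply (va_mult tau _ k); auto using va_cos. }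
  intros s; auto_derive; [eexists; apply Dt|rewrite Et; unfold k; ring].
(* For the speed [v], [dv/dt = - cos t sin t / v] and [tau' = 1 / v], so [1 / v] has derivative
   [cos sin / v^4] along [tau]. *)
- exists (fun s => (k s * k s) * ((k s * k s) * (cos (tau s) * sin (tau s)))); split.
  { apply (va_mult tau (fun s => k s * k s)); [apply va_mult; exact Ak|].
    apply (va_mult tau (fun s => k s * k s)); [apply va_mult; exact Ak|].
    apply va_mult; [apply va_cos|apply va_sin]. }
  intros s; assert (P := viviani_speed_ge_1 (tau s)).
  assert (Ds := viviani_speed_derive (tau s)).
  auto_derive.
  + repeat apply conj; try (eexists; eassumption); try (eexists; apply Dt); try lra; exact I.
  + rewrite Et.
    replace (Derive (fun t => viviani_speed t) (tau s))
      with (- (cos (tau s) * sin (tau s)) / viviani_speed (tau s))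
      by (symmetry; apply is_derive_unique; exact Ds).
    unfold k; field; lra.
- exists (fun s => f' s + g' s); split; [apply va_plus; assumption|].
  intros s; apply (is_derive_plus f g s); auto.
- exists (fun s => f' s * g s + f s * g' s); split.
  { apply va_plus; apply va_mult; assumption. }
  intros s; apply (is_derive_mult f g s); auto; intros; apply Rmult_comm.
Qed.

(** * Angular momentum and the properties of Viviani's curve *)

Lemma angular_momentum_formula (xi : R -> vec3) (s : R) :
  angular_momentum xi s =
    px (velocity xi s) * py (xi s) - px (xi s) * py (velocity xi s).
Proof. unfold angular_momentum, det3, px, py, pz; simpl; ring. Qed.

Lemma cos_latitude_sqr (p : vec3) :
  euclid_norm p = 1 -> cos (latitude p) ^ 2 = 1 - pz p ^ 2.
Proof.
intros E; apply euclid_norm_1 in E; unfold latitude.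
assert (B : -1 <= pz p <= 1) by nra.
rewrite cos_asin by exact B; rewrite pow2_sqrt; unfold Rsqr; nra.
Qed.

Lemma viviani_arclength_properties (V : R -> vec3) :
  arclength_parametrization viviani V ->
  smooth V /\
  spherical_curve m_infty p_infty V /\
  z_nonconstant m_infty p_infty V /\
  has_angular_momentum m_infty p_infty V
    (fun phi => - (cos phi) ^ 2 / sqrt (1 + (cos phi) ^ 2)).
Proof.
intros HV; assert (HV' := HV).
destruct HV' as [_ [_ [_ [_ U]]]].
destruct (viviani_arclength_tau V HV) as [tau [Dt [St E]]].
assert (T : forall s, cos (tau s) ^ 2 + sin (tau s) ^ 2 = 1)
  by (intros s; rewrite Rplus_comm, <- !Rsqr_pow2; apply sin2_cos2).
assert (N : forall s, euclid_norm (V s) = 1).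
{ intros s; apply euclid_norm_1; rewrite E.
  unfold viviani, geographic, px, py, pz; simpl fst; simpl snd.
  specialize (T s).
  transitivity (cos (tau s) ^ 2 * (cos (tau s) ^ 2 + sin (tau s) ^ 2) + sin (tau s) ^ 2);
    [ring|rewrite T; lra]. }
split; [|split; [|split]].
- assert (C := ex_derive_n_of_closed _ (viviani_algebra_derive tau Dt)).
  intros n s; split; [|split].
  + apply ex_derive_n_ext with (fun u => cos (tau u) * cos (tau u)).
    * intros u; rewrite E; reflexivity.
    * apply C, va_mult; apply va_cos.
  + apply ex_derive_n_ext with (fun u => cos (tau u) * sin (tau u)).
    * intros u; rewrite E; reflexivity.
    * apply C, va_mult; [apply va_cos|apply va_sin].
  + apply ex_derive_n_ext with (fun u => sin (tau u)).
    * intros u; rewrite E; reflexivity.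
    * apply C, va_sin.
- split; [exact I|]; intros s _; split; [apply N|apply U].
- intros [c Hc].
  (* The angle takes every value, in particular these two, where the heights are 0 and 1. *)
  destruct (St 0) as [s0 H0]; destruct (St (PI / 2)) as [s1 H1].
  assert (K0 := Hc s0 (conj I I)); assert (K1 := Hc s1 (conj I I)).
  rewrite E, H0 in K0; rewrite E, H1 in K1.
  unfold viviani, geographic, pz in K0, K1; simpl in K0, K1.
  rewrite sin_0 in K0; rewrite sin_PI2 in K1; lra.
- intros s _; rewrite (cos_latitude_sqr _ (N s)), angular_momentum_formula.
  destruct (viviani_reparam_derive V tau s _ E (Dt s)) as [_ ->]; rewrite E.
  unfold viviani, geographic, px, py, pz; simpl fst; simpl snd.
  specialize (T s); replace (1 - sin (tau s) ^ 2) with (cos (tau s) ^ 2) by lra.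
  fold (viviani_speed (tau s)); assert (P := viviani_speed_ge_1 (tau s)).
  transitivity (- cos (tau s) ^ 2 * (cos (tau s) ^ 2 + sin (tau s) ^ 2)
                 / viviani_speed (tau s)); [|rewrite T]; field; lra.
Qed.

(** * Uniqueness up to rotation and parameter shift *)

Lemma curve_viviani_system (a b : Rbar) (xi : R -> vec3) :
  spherical_curve a b xi ->
  has_angular_momentum a b xi
    (fun phi => - (cos phi) ^ 2 / sqrt (1 + (cos phi) ^ 2)) ->
  viviani_system a b (fun s => px (xi s)) (fun s => py (xi s)) (fun s => pz (xi s))
    (Derive (fun s => px (xi s))) (Derive (fun s => py (xi s)))
    (Derive (fun s => pz (xi s))).
Proof.
intros [_ H] M s Hs; destruct (H s Hs) as [N [[Ex [Ey Ez]] U]].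
split; [|split; [|split]].
- split; [|split]; apply Derive_correct; assumption.
- apply euclid_norm_1, N.
- apply euclid_norm_1 in U; exact U.
- specialize (M s Hs); rewrite angular_momentum_formula in M; unfold velocity in M.
  cbn [px py fst snd] in M.
  rewrite (cos_latitude_sqr _ N) in M.
  replace (1 + (1 - pz (xi s) ^ 2)) with (2 - pz (xi s) ^ 2) in M by ring.
  unfold Rdiv in *; lra.
Qed.

(** The equation is separable: [viviani_arc (T s)] has derivative 1. Together with injectivity of
    the arc this replaces a uniqueness theorem for differential equations. *)
Lemma viviani_arc_phase (a b : Rbar) (T : R -> R) :
  (forall s, in_interval a b s -> is_derive T s (/ sqrt (1 + cos (T s) ^ 2))) ->
  forall s t, in_interval a b s -> in_interval a b t ->
  viviani_arc (T s) - s = viviani_arc (T t) - t.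
Proof.
intros D; apply (derive_0_const a b (fun s => viviani_arc (T s) - s)).
intros s Hs; specialize (D s Hs); fold (viviani_speed (T s)) in D.
assert (P := viviani_speed_ge_1 (T s)); assert (F := viviani_arc_derive (T s)).
auto_derive; [repeat apply conj; try (eexists; eassumption); exact I|].
replace (Derive (fun u => T u) s) with (/ viviani_speed (T s))
  by (symmetry; apply is_derive_unique; exact D).
replace (Derive (fun u => viviani_arc u) (T s)) with (viviani_speed (T s))
  by (symmetry; apply is_derive_unique; exact F).
field; lra.
Qed.

Theorem corollary6p1 :
  (exists V : R -> vec3, arclength_parametrization viviani V) /\
  forall V : R -> vec3, arclength_parametrization viviani V ->
    (smooth V /\
     spherical_curve m_infty p_infty V /\
     z_nonconstant m_infty p_infty V /\
     has_angular_momentum m_infty p_infty V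
       (fun phi => - (cos phi) ^ 2 / sqrt (1 + (cos phi) ^ 2))) /\
    (forall (a b : Rbar) (xi : R -> vec3),
       spherical_curve a b xi ->
       z_nonconstant a b xi ->
       has_angular_momentum a b xi
         (fun phi => - (cos phi) ^ 2 / sqrt (1 + (cos phi) ^ 2)) ->
       exists theta s0 : R,
         forall s, in_interval a b s -> xi s = rot_z theta (V (s + s0))).
Proof.
split; [eexists; exact viviani_arclength_ex|].
intros V HV; split; [exact (viviani_arclength_properties V HV)|].
intros a b xi Hxi _ M; assert (Hab := proj1 Hxi).
assert (H := curve_viviani_system a b xi Hxi M).
destruct (system_phase _ _ _ _ _ _ _ _ Hab H) as [T HT].
destruct (system_longitude _ _ _ _ _ _ _ _ Hab H) as [theta Hth].
destruct (viviani_arclength_tau V HV) as [tau [Dt [St E]]].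
destruct (in_interval_inhabited a b Hab) as [s1 H1].
(* [r] is a parameter at which [V] has the angle [T s1]; the shift [r - s1] therefore matches the
   two phases at [s1]. *)
destruct (St (T s1)) as [r Hr].
exists theta, (r - s1); intros s Hs.
(* Both phases have arc equal to parameter plus a constant, and they agree at [s1], so their arcs
   agree at every [s]. *)
assert (K : tau (s + (r - s1)) = T s).
{ apply viviani_arc_inj.
  assert (A1 := viviani_arc_phase a b T (fun u Hu => proj1 (HT u Hu)) s s1 Hs H1).
  assert (A2 := viviani_arc_phase m_infty p_infty tau (fun u _ => Dt u)
                  (s + (r - s1)) r (conj I I) (conj I I)).
  rewrite Hr in A2; lra. }
destruct (HT s Hs) as [_ [C S]]; destruct (Hth s Hs) as [X Y].
rewrite <- C, <- S in X, Y; rewrite E, K.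
rewrite (surjective_pairing (xi s)), (surjective_pairing (fst (xi s))).
(* With [c = cos T] and [z = sin T], the longitude formula is [cos T e^(i T)] rotated by [theta]. *)
unfold px, py, pz in *; unfold rot_z, viviani, geographic, px, py, pz.
cbn [fst snd] in *; rewrite X, Y, <- S; f_equal; f_equal; ring.
Qed.
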